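(* Let $m$ be the measure driven by a Markov chain $X$ on $\mathcal{S}=\{0,\dots,\ell-1\}$ with initial distribution $(p_i)_{i\in\mathcal{S}}$ and irreducible transition matrix $P$. Denote by $L_k$ the $k$-th row of $P$ ($k\in\mathcal{S}$), and let $H=(h_\ell(L_0),\dots,h_\ell(L_{\ell-1}))$ be the vector of entropies of the rows of $P$. Then $$\dim(m)=\langle\pi\mid H\rangle=\sum_{k\in\mathcal{S}}\pi_k\,h_\ell(L_k),$$ where $\pi$ is the stationary distribution of $X$ (the unique probability row vector with $\pi P=\pi$) and $\langle\,\cdot\mid\cdot\,\rangle$ is the canonical scalar product on $\mathbb{R}^\ell$.
   Context: Let $\ell\ge 2$ be an integer and $\mathcal{S}=\{0,1,\dots,\ell-1\}$. For $n\ge1$ and a word $\varepsilon_1\cdots\varepsilon_n\in\mathcal{S}^n$ let $I_{\varepsilon_1\cdots\varepsilon_n}=\big[\sum_{i=1}^n\varepsilon_i\ell^{-i},\ \sum_{i=1}^n\varepsilon_i\ell^{-i}+\ell^{-n}\big)$. A probability vector $(p_i)_{i\in\mathcal{S}}$ (initial distribution) and a stochastic matrix $P=(p_{ij})_{i,j\in\mathcal{S}}$ (transition matrix) are given; it is always assumed that $p_{ij}\neq 1$ for all $i,j$. The measure driven by the Markov chain is the unique Borel probability measure $m$ carried by $[0,1)$ with $m(I_{\varepsilon_1\cdots\varepsilon_n})=p_{\varepsilon_1}p_{\varepsilon_1\varepsilon_2}\cdots p_{\varepsilon_{n-1}\varepsilon_n}$ for all words. $P$ is irreducible if for all $i,j$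 there is $n\ge1$ with $(P^n)_{ij}>0$. For a probability vector $p=(p_0,\dots,p_{\ell-1})$, $h_\ell(p)=-\sum_{i=0}^{\ell-1}p_i\log_\ell p_i$ (with $0\log_\ell 0=0$). For a Borel probability measure $\mu$ on $\mathbb{R}$: $\dim_*\mu=\inf\{\dim_H E: E\text{ Borel},\ \mu(E)>0\}$ and $\dim^*\mu=\inf\{\dim_H E: E\text{ Borel},\ \mu(E)=1\}$. If they coincide, $\mu$ is called unidimensional and the common value is $\dim\mu$. The assertion includes that $\dim(m)$ is well defined. *)

(* Defs.v *)
From HB Require Import structures.
From mathcomp Require Import all_boot all_order all_algebra.
From mathcomp Require Import all_classical all_reals all_analysis.

Set Implicit Arguments.
Unset Strict Implicit.
Unset Printing Implicit Defensive.
Import Order.TTheory GRing.Theory Num.Theory.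
Import numFieldNormedType.Exports.

Local Open Scope classical_set_scope.
Local Open Scope ring_scope.

Section HausdorffDimension.
Context {R : realType}.
Implicit Types (U E : set R) (s d : R).
Local Open Scope ereal_scope.

(* The supremum over the empty set is -oo, so the diameter of set0 is -oo. *)
Definition diameter U : \bar R :=
  ereal_sup [set `|z.1 - z.2|%:E | z in U `*` U].

(* diam(U)^s, where set0 contributes 0 for every s; for s = 0 a nonempty set
   contributes 1, even when it is a single point (poweR 0 0 = 1). *)
Definition gauge s U : \bar R :=
  if U == set0 then 0 else poweR (diameter U) s.

Definition delta_cover d E (U : nat -> set R) : Prop :=
  E `<=` \bigcup_n U n /\ forall n, diameter (U n) <= d%:E.

Definition hausdorff_premeasure s d E : \bar R :=
  ereal_inf [set \sum_(0 <= n <oo) gauge s (U n) | U in delta_cover d E].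

(* The premeasure is nonincreasing in d: the supremum over d > 0 is the limit
   as d tends to 0. *)
Definition hausdorff_measure s E : \bar R :=
  ereal_sup [set hausdorff_premeasure s d E | d in [set d : R | (0 < d)%R]].

Definition hausdorff_dim E : \bar R :=
  ereal_inf [set s%:E | s in [set s : R | (0 <= s)%R /\
                                          hausdorff_measure s E = 0]].

End HausdorffDimension.

Section MeasureDimension.
Context {R : realType}.
(* The measurable sets of measurableTypeR R are the Borel sets of R. *)
Implicit Type mu : probability (measurableTypeR R) R.
Local Open Scope ereal_scope.

Definition lower_dim mu : \bar R :=
  ereal_inf [set hausdorff_dim E |
             E in [set E | measurable E /\ 0 < mu E]].

Definition upper_dim mu : \bar R :=
  ereal_inf [set hausdorff_dim E |
             E in [set E | measurable E /\ mu E = 1]].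

Definition unidimensional mu : Prop := lower_dim mu = upper_dim mu.

(* Only meaningful when mu is unidimensional. *)
Definition measure_dim mu : \bar R := lower_dim mu.

End MeasureDimension.

Section MarkovChain.
Context {R : realType} {l : nat}.
Implicit Types (p : 'rV[R]_l) (P : 'M[R]_l).

Definition probability_vector p : Prop :=
  (forall i, 0 <= p 0 i) /\ \sum_i p 0 i = 1.

Definition stochastic P : Prop := forall i, probability_vector (row i P).

Definition irreducible P : Prop :=
  forall i j, exists n : nat, (0 < n)%N /\ 0 < (P ^+ n) i j.

Definition stationary P p : Prop := probability_vector p /\ p *m P = p.

(* A word e_1 ... e_(n+1) is a tuple w with tnth w k = e_(k+1), so that the
   digit tnth w k has weight l^-(k+1). *)
Definition ladic_left n (w : n.+1.-tuple 'I_l) : R :=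
  \sum_(k < n.+1) (tnth w k)%:R * l%:R ^- k.+1.

Definition ladic_interval n (w : n.+1.-tuple 'I_l) : set R :=
  [set` `[ladic_left w, ladic_left w + l%:R ^- n.+1[].

Definition word_prob p P n (w : n.+1.-tuple 'I_l) : R :=
  p 0 (tnth w ord0) *
  \prod_(k < n) P (tnth w (widen_ord (leqnSn n) k)) (tnth w (lift ord0 k)).

Definition driven_by p P (m : probability (measurableTypeR R) R) : Prop :=
  m `[0, 1[%classic = 1%E /\
  forall n (w : n.+1.-tuple 'I_l), m (ladic_interval w) = (word_prob p P w)%:E.

(* Entropy in base l. The terms with p 0 i = 0 vanish, as required. *)
Definition entropy p : R :=
  - \sum_i p 0 i * (ln (p 0 i) / ln l%:R).

Definition row_entropies P : 'rV[R]_l := \row_k entropy (row k P).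

Definition dot (u v : 'rV[R]_l) : R := \sum_k u 0 k * v 0 k.

End MarkovChain.

(* Main.v *)
(* By Billingsley's principle the dimension is the almost sure value of
   [- log_l m(I_n(x)) / n].  Let [f i = \sum_j P i j * ln (P i j)] and let [g] solve the
   Poisson equation [g - P g = f - <pi, f>].  Along a trajectory, [ln m(I_n)] is
   [n <pi, f>] plus a bounded coboundary plus a sum of the increments
   [a i j = ln (P i j) + g j - g i - <pi, f>], which are centred under each row of [P].
   For small [t > 0] the matrix [P i j * exp (t (a i j - e))] is substochastic, so
   deviations of this sum have exponentially small probability, and Borel-Cantelli
   gives the almost sure rate.  The mass distribution principle then bounds the
   lower dimension from below, and covering by the typical cells bounds the upper
   dimension from above. *)
Require Import Defs.
From HB Require Import structures.
From mathcomp Require Import all_boot all_order all_algebra.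
From mathcomp Require Import all_classical all_reals all_analysis.
From mathcomp Require Import ring lra zify.

Import Order.TTheory GRing.Theory Num.Theory.
Import numFieldNormedType.Exports.

Local Open Scope classical_set_scope.
Local Open Scope ring_scope.

(** * Large deviations along words *)

Section Words.
Context {R : realType} {l : nat}.
Implicit Types (p : 'rV[R]_l) (P Q : 'M[R]_l).

Lemma big_cons_tuple n (F : n.+1.-tuple 'I_l -> R) :
  \sum_w F w = \sum_i \sum_(w : n.-tuple 'I_l) F (cons_tuple i w).
Proof.
rewrite pair_bigA/= (reindex (fun x : 'I_l * n.-tuple 'I_l => cons_tuple x.1 x.2))//=.
exists (fun w : n.+1.-tuple 'I_l => (thead w, behead_tuple w)).
- by move=> [i w] _ /=; congr (_, _); apply/val_inj.
- by move=> w _ /=; rewrite [RHS]tuple_eta; apply/val_inj.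
Qed.

(** Markov property at the first letter: the rest is a word of the chain restarted from [row i Q],
    so inductions on the length let [p] vary. *)
Lemma word_prob_cons p Q n i (w : n.+1.-tuple 'I_l) :
  word_prob p Q (cons_tuple i w) = p 0 i * word_prob (row i Q) Q w.
Proof.
rewrite /word_prob big_ord_recl !mxE; congr (_ * (_ * _)).
  by congr (Q _ _); rewrite !(tnth_nth i).
by apply: eq_bigr => k _; rewrite !(tnth_nth i).
Qed.

Lemma word_prob_ge0 p Q n (w : n.+1.-tuple 'I_l) :
  (forall i, 0 <= p 0 i) -> (forall i j, 0 <= Q i j) -> 0 <= word_prob p Q w.
Proof. by move=> p0 Q0; rewrite mulr_ge0// prodr_ge0. Qed.

(** Stated for substochastic [Q], so as to apply both to [P] and to its exponential tilts. *)
Lemma sum_word_prob_le p Q n :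
  (forall i, 0 <= p 0 i) -> (forall i j, 0 <= Q i j) ->
  (forall i, \sum_j Q i j <= 1) ->
  \sum_(w : n.+1.-tuple 'I_l) word_prob p Q w <= \sum_i p 0 i.
Proof.
move=> + Q0 Q1; elim: n p => [|n IH] p p0; rewrite big_cons_tuple.
  apply: ler_sum => i _; rewrite (big_pred1 [tuple])/=; last first.
    by move=> w; apply/esym/eqP; exact: tuple0.
  by rewrite /word_prob big_ord0 mulr1.
apply: ler_sum => i _; under eq_bigr do rewrite word_prob_cons.
rewrite -mulr_sumr ler_piMr//; apply: le_trans (IH _ _) _ => [j|].
  by rewrite mxE.
by apply: le_trans (Q1 i); apply: ler_sum => j _; rewrite mxE.
Qed.

Definition path_sum (a : 'I_l -> 'I_l -> R) {n} (w : n.+1.-tuple 'I_l) : R :=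
  \sum_(k < n) a (tnth w (widen_ord (leqnSn n) k)) (tnth w (lift ord0 k)).

(** Inverting [1 - x <= expR (- x)] leaves [1 <= (1 - x) * (1 + x + 2 * x ^+ 2)], whose right side
    is [1 + x ^+ 2 * (1 - 2 * x)]. *)
Lemma expR_le_quadratic (x : R) : x <= 2^-1 -> expR x <= 1 + x + 2 * x ^+ 2.
Proof.
move=> x2; have := expR_ge1Dx (- x); rewrite expRN => h.
have e0 := expR_gt0 x.
have : (1 - x) * expR x <= 1.
  by rewrite -ler_pdivlMr// div1r.
nra.
Qed.

(** As [a] is centred, the row sum is [1 - t e + O(t^2)], and for small [t] the drift beats the
    quadratic term. *)
Lemma substochastic_tilt P (a : 'I_l -> 'I_l -> R) (e : R) :
  stochastic P -> (forall i, \sum_j P i j * a i j = 0) -> 0 < e ->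
  exists2 t, 0 < t & forall i, \sum_j P i j * expR (t * (a i j - e)) <= 1.
Proof.
move=> Ps Pa e0.
pose B := 1 + \sum_i \sum_j `|a i j - e|.
have B1 : 1 <= B by rewrite lerDl sumr_ge0// => i _; rewrite sumr_ge0.
have aB i j : `|a i j - e| <= B.
  rewrite /B (bigD1 i)//= (bigD1 j)//= addrCA -addrA lerDl.
  by rewrite !addr_ge0// ?sumr_ge0// => k _; rewrite ?sumr_ge0.
(* The first summand gives [t * B <= 1/2], the range of the quadratic bound; the second lets [t * e]
   absorb the quadratic term. *)
pose t := (2 * B + 2 * B ^+ 2 / e)^-1.
have d0 : 0 < 2 * B + 2 * B ^+ 2 / e.
  by rewrite ltr_wpDr ?divr_ge0 ?mulr_ge0 ?sqr_ge0 ?ltW//; lra.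
have t0 : 0 < t by rewrite invr_gt0.
have tB : t * B <= 2^-1.
  rewrite mulrC ler_pdivrMr// mulrDr mulrA mulVf ?pnatr_eq0// mul1r lerDl.
  rewrite mulr_ge0// divr_ge0 ?(ltW e0)// mulr_ge0 ?sqr_ge0//.
have tBe : t * (2 * B ^+ 2) <= e.
  rewrite mulrC ler_pdivrMr// mulrDr (mulrC e (_ / e)) divfK ?gt_eqF// lerDr.
  by rewrite !mulr_ge0 ?ltW//; lra.
exists t => // i.
have [P0 P1] := Ps i.
have {}P1 : \sum_j P i j = 1 by rewrite -P1; apply: eq_bigr => j _; rewrite mxE.
have {}P0 j : 0 <= P i j by have := P0 j; rewrite mxE.
apply: (@le_trans _ _ (\sum_j P i j * (1 + t * (a i j - e) + t * e))).
  apply: ler_sum => j _; rewrite ler_wpM2l//.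
  have := aB i j; rewrite ler_norml => /andP[b1 b2].
  apply: le_trans (expR_le_quadratic _ _) _; first nra.
  rewrite lerD2l exprMn.
  have : (a i j - e) ^+ 2 <= B ^+ 2 by nra.
  nra.
rewrite (eq_bigr (fun j => P i j + t * (P i j * a i j))); last by move=> j _; ring.
by rewrite big_split/= P1 -mulr_sumr Pa mulr0 addr0.
Qed.

(** Chernoff bound. The matrix tilted at drift [e / 2] gives total mass at most 1, while each word
    of the tail carries a tilt factor of at least [expR (n t e / 2)]. *)
Lemma path_sum_tail p P (a : 'I_l -> 'I_l -> R) (e : R) :
  probability_vector p -> stochastic P ->
  (forall i, \sum_j P i j * a i j = 0) -> 0 < e ->
  exists2 q, 0 < q < 1 & forall n,
    \sum_(w : n.+1.-tuple 'I_l | n%:R * e <= path_sum a w) word_prob p P w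
      <= q ^+ n.
Proof.
move=> [p0 p1] Ps Pa e0.
have e20 : 0 < e / 2 by lra.
have [t t0 tP] := substochastic_tilt P a (e / 2) Ps Pa e20.
have P0 i j : 0 <= P i j by have [+ _] := Ps i => /(_ j); rewrite mxE.
pose Q := \matrix_(i, j) (P i j * expR (t * (a i j - e / 2))).
have Q0 i j : 0 <= Q i j by rewrite mxE mulr_ge0// expR_ge0.
have QE n (w : n.+1.-tuple 'I_l) :
    word_prob p Q w = word_prob p P w * expR (t * (path_sum a w - n%:R * (e / 2))).
  rewrite /word_prob -mulrA; congr (_ * _).
  rewrite (_ : n%:R * (e / 2) = \sum_(k < n) (e / 2)); last first.
    by rewrite sumr_const card_ord mulr_natl.
  rewrite /path_sum -sumrB mulr_sumr expR_sum -big_split/=.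
  by apply: eq_bigr => k _; rewrite mxE.
exists (expR (- (t * (e / 2)))).
  by rewrite expR_gt0 expR_lt1 oppr_lt0 mulr_gt0.
move=> n; rewrite -expRM_natl mulrN.
rewrite expRN -[leRHS]div1r ler_pdivlMr ?expR_gt0// -[leRHS]p1.
apply: le_trans (sum_word_prob_le p Q n _ _ _) => //; last first.
  by move=> i; apply: le_trans (tP i); apply: ler_sum => j _; rewrite mxE.
rewrite mulr_suml big_mkcond/=; apply: ler_sum => w _.
case: ifPn => [h|_]; last exact: word_prob_ge0.
rewrite QE ler_wpM2l ?word_prob_ge0// ler_expR.
rewrite mulrCA ler_pM2l//.
have -> : n%:R * (e / 2) = n%:R * e / 2 by ring.
lra.
Qed.

End Words.

(** * The Poisson equation *)

Section Poisson.
Context {R : realType} {l : nat}.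
Implicit Types (P : 'M[R]_l) (pi : 'rV[R]_l) (f u : 'cV[R]_l).

Lemma stochastic_ge0 P i j : stochastic P -> 0 <= P i j.
Proof. by move=> /(_ i)[/(_ j)]; rewrite mxE. Qed.

Lemma stochastic_sum P i : stochastic P -> \sum_j P i j = 1.
Proof. by move=> /(_ i)[_ <-]; apply: eq_bigr => j _; rewrite mxE. Qed.

Lemma mulmx_expr_fixed P u n : P *m u = u -> P ^+ n *m u = u.
Proof.
move=> Pu; elim: n => [|n IH]; first exact: mul1mx.
by rewrite exprS (_ : P * P ^+ n = P *m P ^+ n)// -mulmxA IH.
Qed.

Lemma expr_stochastic_ge0 P n i j : stochastic P -> 0 <= (P ^+ n) i j.
Proof.
move=> Ps; elim: n i j => [|n IH] i j; first by rewrite expr0 !mxE ler0n.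
rewrite exprS (_ : P * P ^+ n = P *m P ^+ n)// mxE sumr_ge0// => k _.
by rewrite mulr_ge0// stochastic_ge0.
Qed.

Lemma expr_stochastic_sum P n i : stochastic P -> \sum_j (P ^+ n) i j = 1.
Proof.
move=> Ps; have : P ^+ n *m const_mx 1 = const_mx 1 :> 'cV[R]_l.
  apply: mulmx_expr_fixed; apply/colP => k; rewrite !mxE -[RHS](stochastic_sum P k)//.
  by apply: eq_bigr => j _; rewrite mxE mulr1.
move=> /colP /(_ i); rewrite !mxE => <-.
by apply: eq_bigr => j _; rewrite [X in _ * X]mxE mulr1.
Qed.

(** Maximum principle: at a maximiser [k], [u] equals its average under row [k] of [P ^+ n], hence
    is maximal wherever that row is positive; irreducibility reaches every [j]. *)
Lemma irreducible_fixed_const P u i j :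
  stochastic P -> irreducible P -> P *m u = u -> u i 0 = u j 0.
Proof.
move=> Ps Pirr Pu.
suff [k uk] : exists k, forall j, u j 0 = u k 0 by rewrite !uk.
exists [arg max_(k > i) u k 0]%O => {}j; case: arg_maxP => // k _ kmax.
have [n [_ Pn]] := Pirr k j.
have s0 : \sum_j (P ^+ n) k j * (u k 0 - u j 0) = 0.
  under eq_bigr do rewrite mulrBr.
  rewrite sumrB -mulr_suml expr_stochastic_sum// mul1r.
  by have /colP/(_ k) := mulmx_expr_fixed P u n Pu; rewrite mxE => ->; rewrite subrr.
have /psumr_eq0P/(_ s0)/(_ j isT) : forall j, xpredT j ->
    0 <= (P ^+ n) k j * (u k 0 - u j 0).
  move=> h _; rewrite mulr_ge0 ?expr_stochastic_ge0// subr_ge0; exact: kmax.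
by move=> /eqP; rewrite mulf_eq0 gt_eqF//= subr_eq0 => /eqP.
Qed.

(* The row space of [(1 - P)^T] has codimension one, since [P]-harmonic vectors
   are constant, and is contained in the orthogonal of [pi], hence equal to it. *)
Lemma poisson_equation P pi f :
  stochastic P -> irreducible P -> stationary P pi ->
  exists g, g - P *m g = f - const_mx ((pi *m f) 0 0).
Proof.
move=> Ps Pirr [[pi0 pi1] piP].
pose M := (1%:M - P)^T.
have pi_neq0 : pi != 0.
  apply/eqP => pi00; move: pi1; rewrite pi00 big1 => [/esym/eqP|i _].
    by rewrite oner_eq0.
  by rewrite mxE.
have /rV0Pn[i0 _] := pi_neq0.
have kerM : (kermx M <= (const_mx 1 : 'rV[R]_l))%MS.
  apply/row_subP => i; set u := row i _.
  have uM : u *m M = 0 by rewrite -row_mul mulmx_ker row0.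
  apply/submxP; exists (const_mx (u 0 i0)).
  apply/rowP => j; rewrite [RHS]mxE big_ord1 !(mxE const_mx_key) mulr1.
  have := @irreducible_fixed_const P u^T j i0 Ps Pirr; rewrite ![u^T _ _]mxE; apply.
  move/(congr1 trmx) : uM; rewrite trmx_mul trmxK mulmxBl mul1mx trmx0 => /eqP.
  by rewrite subr_eq0 => /eqP <-.
have Mpi : (M <= kermx pi^T)%MS.
  apply/sub_kermxP; rewrite -trmx_mul mulmxBr mulmx1 piP subrr.
  exact: trmx0.
(* Rank count: [kermx M] has rank at most 1, so [M] has rank at least [l - 1], the rank of
   [kermx pi^T]. *)
have eqM : (kermx pi^T <= M)%MS.
  rewrite -(mxrank_leqif_sup Mpi) eqn_leq mxrankS//= mxrank_ker.
  rewrite mxrank_tr rank_rV pi_neq0 leq_subLR.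
  have := mxrankS kerM; rewrite mxrank_ker rank_rV leq_subLR => /leq_trans; apply.
  by rewrite addnC leq_add2r; case: (_ != _).
have /submxP[D hD] : ((f - const_mx ((pi *m f) 0 0))^T <= M)%MS.
  apply: submx_trans eqM; apply/sub_kermxP.
  rewrite -trmx_mul mulmxBr; apply/matrixP => i j; rewrite !ord1 !mxE.
  apply/eqP; rewrite subr_eq0; apply/eqP.
  under [RHS]eq_bigr do rewrite mxE.
  by rewrite -mulr_suml pi1 mul1r.
exists D^T; move/(congr1 trmx) : hD; rewrite trmxK trmx_mul trmxK => ->.
by rewrite mulmxBl mul1mx.
Qed.

End Poisson.

Lemma natr_mul_ge_eventually {R : realType} (a b : R) : 0 < a ->
  exists N, forall n, (N <= n)%N -> b <= n%:R * a.
Proof.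
move=> a0; exists (Num.bound (`|b| / a)) => n hn.
apply: le_trans (ler_norm _) _; rewrite -ler_pdivrMr//.
apply: le_trans (ltW (archi_boundP _)) _; last by rewrite ler_nat.
by rewrite divr_ge0// ltW.
Qed.

(** * Exponential decay of the mass of atypical words *)

Section Deviation.
Context {R : realType} {l : nat}.
Implicit Types (p pi : 'rV[R]_l) (P : 'M[R]_l).

Lemma ln_natr_gt0 : (2 <= l)%N -> 0 < ln (l%:R : R).
Proof. by move=> l2; rewrite ln_gt0// ltr1n. Qed.

Lemma entropy_ge0 p : (2 <= l)%N -> probability_vector p -> 0 <= entropy p.
Proof.
move=> l2 [p0 p1]; rewrite /entropy -sumrN sumr_ge0// => i _.
have pi1 : p 0 i <= 1 by rewrite -p1 (bigD1 i)//= lerDl sumr_ge0.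
by rewrite -mulrN mulr_ge0// -mulNr divr_ge0 ?oppr_ge0 ?ln_le0// ltW// ln_natr_gt0.
Qed.

Lemma dot_entropies_ge0 P pi :
  (2 <= l)%N -> stochastic P -> probability_vector pi ->
  0 <= dot pi (row_entropies P).
Proof.
move=> l2 Ps [pi0 _]; rewrite sumr_ge0// => k _; rewrite mulr_ge0// mxE.
exact: entropy_ge0.
Qed.

Lemma dot_entropies_ln P pi : (2 <= l)%N ->
  dot pi (row_entropies P) * ln l%:R =
  - \sum_i pi 0 i * \sum_j P i j * ln (P i j).
Proof.
move=> l2; have l0 := lt0r_neq0 (ln_natr_gt0 l2).
rewrite /dot mulr_suml -sumrN; apply: eq_bigr => i _.
rewrite mxE /entropy -mulrA -mulrN mulNr; congr (_ * - _).
rewrite mulr_suml; apply: eq_bigr => j _.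
by rewrite mxE -mulrA divfK.
Qed.

Lemma word_prob_gt0 p P n (w : n.+1.-tuple 'I_l) :
  probability_vector p -> stochastic P -> 0 < word_prob p P w ->
  0 < p 0 (tnth w ord0) /\ forall k : 'I_n,
  0 < P (tnth w (widen_ord (leqnSn n) k)) (tnth w (lift ord0 k)).
Proof.
move=> [p0 _] Ps /lt0r_neq0; rewrite mulf_eq0 negb_or => /andP[pw /prodf_neq0 Pw].
split=> [|k]; first by rewrite lt0r pw p0.
by rewrite lt0r Pw//= stochastic_ge0.
Qed.

(** Positivity matters: [ln] takes the default value 0 at 0, so the sum formula may fail on words of
    probability zero. *)
Lemma ln_word_prob p P n (w : n.+1.-tuple 'I_l) :
  probability_vector p -> stochastic P -> 0 < word_prob p P w ->
  ln (word_prob p P w) =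
  ln (p 0 (tnth w ord0)) + path_sum (fun i j => ln (P i j)) w.
Proof.
move=> pp Ps /(word_prob_gt0 p P n w pp Ps)[p0 Pw].
rewrite -[RHS]expRK expRD expR_sum lnK ?posrE//; congr (ln (_ * _)).
by apply: eq_bigr => k _; rewrite lnK ?posrE.
Qed.

Lemma path_sum_telescope (g : 'I_l -> R) n (w : n.+1.-tuple 'I_l) :
  path_sum (fun i j => g j - g i) w = g (tnth w ord_max) - g (tnth w ord0).
Proof.
pose G k := g (tnth w (inord k)).
have -> : ord_max = inord n :> 'I_n.+1 by apply/val_inj; rewrite /= inordK.
have -> : ord0 = inord 0 :> 'I_n.+1 by apply/val_inj; rewrite /= inordK.
rewrite -/(G n) -/(G 0) -telescope_sumr// big_mkord.
apply: eq_bigr => k _; rewrite /G; congr (g (tnth w _) - g (tnth w _)).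
  by apply/val_inj; rewrite /= inordK// ltnS ltn_ord.
by apply/val_inj; rewrite /= inordK// ltnW// ltnS ltn_ord.
Qed.

(* The increments are those of [ln (word_prob p P w)], centred and corrected
   by the coboundary of a solution [g] of the Poisson equation. *)
Lemma ln_word_prob_martingale p P pi :
  (2 <= l)%N -> probability_vector p -> stochastic P -> irreducible P ->
  stationary P pi ->
  exists2 a : 'I_l -> 'I_l -> R, forall i, \sum_j P i j * a i j = 0 &
  exists K, forall n (w : n.+1.-tuple 'I_l), 0 < word_prob p P w ->
  `|ln (word_prob p P w) + n%:R * (dot pi (row_entropies P) * ln l%:R)
     - path_sum a w| <= K.
Proof.
move=> l2 pp Ps Pirr pis.
pose f : 'cV[R]_l := \col_i \sum_j P i j * ln (P i j).
have [g hg] := @poisson_equation R l P pi f Ps Pirr pis.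
set c := dot _ _ * _.
have pif : (pi *m f) 0 0 = - c.
  rewrite /c dot_entropies_ln// opprK mxE; apply: eq_bigr => i _.
  by rewrite [f _ _]mxE.
(* Here [c = - <pi, f>]; under row [i] the increment averages to [f i + (P g) i - g i + c], which is
   zero by the Poisson equation. *)
exists (fun i j => ln (P i j) + (g j 0 - g i 0) + c).
  move=> i; move/colP : hg => /(_ i); rewrite pif !mxE => hg.
  under eq_bigr do rewrite !mulrDr.
  rewrite 2!big_split/= -mulr_suml stochastic_sum// mul1r.
  under [X in _ + X + _]eq_bigr do rewrite mulrN.
  rewrite big_split/= sumrN -mulr_suml stochastic_sum// mul1r.
  lra.
(* After telescoping, only [ln (p 0 _)] at the first letter and [g] at both ends remain; sums over
   the alphabet bound them. *)
exists (\sum_i `|ln (p 0 i)| + (\sum_i `|g i 0| + \sum_i `|g i 0|)) => n w w0.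
have -> : path_sum (fun i j => ln (P i j) + (g j 0 - g i 0) + c) w =
    path_sum (fun i j => ln (P i j)) w + (g (tnth w ord_max) 0 - g (tnth w ord0) 0)
    + n%:R * c.
  rewrite -(path_sum_telescope (fun i => g i 0)) /path_sum !big_split/=.
  by rewrite sumr_const card_ord mulr_natl.
rewrite ln_word_prob//.
set u := ln _; set v := path_sum _ _; set g1 := g _ _; set g0 := g _ _.
have -> : u + v + n%:R * c - (v + (g1 - g0) + n%:R * c) = u + (g0 - g1) by ring.
have le_sum (F : 'I_l -> R) i : `|F i| <= \sum_i `|F i|.
  by rewrite (bigD1 i)//= lerDl sumr_ge0.
apply: le_trans (ler_normD _ _) _; apply: lerD.
  exact: (le_sum (fun i => ln (p 0 i))).
apply: le_trans (ler_normB _ _) _.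
by apply: lerD; exact: (le_sum (fun i => g i 0)).
Qed.

(** Null words count as atypical because their logarithm is a default value. The word has [n]
    transitions, and [ln l%:R] converts [D] from base [l]. *)
Definition atypical p P (D d : R) n (w : n.+1.-tuple 'I_l) : bool :=
  (word_prob p P w == 0) ||
  (n%:R * d <= `|ln (word_prob p P w) + n%:R * (D * ln l%:R)|).

Lemma atypical_sum p P pi (d : R) :
  (2 <= l)%N -> probability_vector p -> stochastic P -> irreducible P ->
  stationary P pi -> 0 < d ->
  exists C q, 0 < q < 1 /\ forall n,
    \sum_(w : n.+1.-tuple 'I_l | atypical p P (dot pi (row_entropies P)) d n w)
      word_prob p P w <= C * q ^+ n.
Proof.
move=> l2 pp Ps Pirr pis d0.
have [a Pa [K hK]] := ln_word_prob_martingale p P pi l2 pp Ps Pirr pis.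
have wp0 n (w : n.+1.-tuple 'I_l) : 0 <= word_prob p P w.
  by case: pp => p0 _; rewrite word_prob_ge0// => i j; exact: stochastic_ge0.
have Na i : \sum_j P i j * - a i j = 0.
  by under eq_bigr do rewrite mulrN; rewrite sumrN Pa oppr0.
have d20 : 0 < d / 2 by lra.
have [q1 /andP[q10 q11] h1] := path_sum_tail p P a (d / 2) pp Ps Pa d20.
have [q2 /andP[q20 q21] h2] :=
  path_sum_tail p P (fun i j => - a i j) (d / 2) pp Ps Na d20.
have [n0 n0P] := natr_mul_ge_eventually (d / 2) K d20.
pose q := Num.max q1 q2.
have q0 : 0 < q by rewrite lt_max q10.
have q1' : q < 1 by rewrite gt_max q11.
(* The 2 pays for two tails when [n0 <= n]; for smaller [n] the other term makes the bound at least
   1, the total mass. *)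
exists (2 + (q ^+ n0)^-1), q; split; first by rewrite q0.
move=> n; case: (leqP n0 n) => [n0n|nn0]; last first.
  apply: (@le_trans _ _ 1).
    case: (pp) => p0 <-; apply: le_trans (sum_word_prob_le p P n p0 _ _).
    - by rewrite big_mkcond ler_sum// => w _; case: ifP.
    - by move=> i j; exact: stochastic_ge0.
    - by move=> i; rewrite stochastic_sum.
  have : 1 <= (q ^+ n0)^-1 * q ^+ n.
    rewrite mulrC ler_pdivlMr ?exprn_gt0// mul1r.
    by apply: ler_wiXn2l; rewrite ?(ltW q0) ?(ltW q1') ?(ltnW nn0).
  have : 0 <= q ^+ n by rewrite exprn_ge0// ltW.
  rewrite mulrDl; lra.
apply: (@le_trans _ _ (q1 ^+ n + q2 ^+ n)); last first.
  rewrite mulrDl -[leLHS]addr0 lerD//; last first.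
    by rewrite mulr_ge0 ?invr_ge0 ?exprn_ge0 ?ltW.
  have : q1 ^+ n <= q ^+ n by rewrite lerXn2r ?nnegrE ?(ltW q10) ?(ltW q0)// le_max lexx.
  have : q2 ^+ n <= q ^+ n by rewrite lerXn2r ?nnegrE ?(ltW q20) ?(ltW q0)// le_max lexx orbT.
  lra.
(* Since [K <= n d / 2], an atypical word of positive probability has a path sum of modulus at least
   [n d / 2], so it lies in one of the two tails. *)
apply: le_trans (lerD (h1 n) (h2 n)).
rewrite big_mkcond [X in _ <= X + _]big_mkcond [X in _ <= _ + X]big_mkcond/=.
rewrite -big_split/=; apply: ler_sum => w _.
have /predU1P[->|w0] : (word_prob p P w == 0) || (0 < word_prob p P w).
  by have := wp0 n w; rewrite le_eqVlt eq_sym.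
  by do !case: ifP => _; rewrite addr0.
rewrite /atypical gt_eqF//=; case: ifPn => dev; last first.
  by rewrite addr_ge0//; case: ifP.
have -> : path_sum (fun i j => - a i j) w = - path_sum a w by rewrite /path_sum sumrN.
have := hK n w w0; set x := _ + _ in dev *; set y := path_sum a w => xy.
have := n0P n n0n; set u := n%:R * (d / 2) => Ku.
have nd : n%:R * d = u + u by rewrite /u -mulrDr -splitr.
have : u <= `|y|.
  have : `|x| <= `|x - y| + `|y| by rewrite -{1}(subrK y x) ler_normD.
  lra.
rewrite ler_normr => /orP[->|->]; first by rewrite lerDl; case: ifP.
by rewrite lerDr; case: ifP.
Qed.

End Deviation.

(** * Mass distribution *)

Section Cells.
Context {R : realType} {l : nat}.
Context (l_ge2 : (2 <= l)%N).

Lemma natr_base_gt0 : 0 < l%:R :> R.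
Proof. by rewrite ltr0n (leq_trans _ l_ge2). Qed.

Lemma ladic_left_cons n i (w : n.+1.-tuple 'I_l) :
  ladic_left (cons_tuple i w) = (i%:R + ladic_left w) / l%:R :> R.
Proof.
rewrite /ladic_left big_ord_recl mulrDl; congr (_ + _).
rewrite mulr_suml; apply: eq_bigr => k _; rewrite !(tnth_nth i) /= -mulrA -invfM.
by congr (_ / _); rewrite -exprSr.
Qed.

(** Lets positions of cells of one level be compared as natural numbers. *)
Lemma ladic_left_scaled n (w : n.+1.-tuple 'I_l) :
  exists k : nat, ladic_left w = k%:R * l%:R ^- n.+1 :> R.
Proof.
have l0 := lt0r_neq0 natr_base_gt0.
exists (\sum_(k < n.+1) tnth w k * l ^ (n - k))%N.
rewrite natr_sum mulr_suml; apply: eq_bigr => k _.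
rewrite natrM natrX -mulrA; congr (_ * _).
have kn : (k <= n)%N by rewrite -ltnS.
have -> : l%:R ^- n.+1 = l%:R ^- (n - k) * l%:R ^- k.+1 :> R.
  by rewrite -invfM -exprD addnS subnK.
by rewrite mulVKf// expf_neq0.
Qed.

(** The first digit is the integer part of [l x]; the other digits expand its fractional part. *)
Lemma ladic_interval_exists n (x : R) : 0 <= x < 1 ->
  exists w : n.+1.-tuple 'I_l, ladic_interval w x.
Proof.
have l0 := natr_base_gt0.
have floorl (y : R) : 0 <= y < 1 ->
    exists2 i : 'I_l, i%:R <= l%:R * y & l%:R * y < i%:R + 1.
  move=> /andP[y0 y1].
  have ly0 : 0 <= l%:R * y by rewrite mulr_ge0// ltW.
  have /andP[t0 t1] := truncn_itv ly0.
  have il : (Num.truncn (l%:R * y) < l)%N.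
    by rewrite -(ltr_nat R); apply: le_lt_trans t0 _; rewrite gtr_pMr.
  by exists (Ordinal il) => //=; rewrite natr1.
elim: n x => [|n IH] x x01; have [i i0 i1] := floorl x x01.
  exists [tuple i]; rewrite /ladic_interval /ladic_left big_ord1/= in_itv/=.
  rewrite expr1 -[X in _ < _ + X]div1r -mulrDl ler_pdivrMr// ltr_pdivlMr//.
  by rewrite mulrC i0.
have y01 : 0 <= l%:R * x - i%:R < 1 by lra.
have [w] := IH _ y01; rewrite /ladic_interval/= in_itv/= => /andP[w0 w1].
exists (cons_tuple i w); rewrite /= in_itv/= ladic_left_cons.
have -> : l%:R ^- n.+2 = l%:R ^- n.+1 / l%:R :> R by rewrite exprSr invfM.
rewrite -mulrDl ler_pdivrMr// ltr_pdivlMr//; apply/andP; split; lra.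
Qed.

(** Both endpoints are integer multiples of the cell length, and the distance bound puts the
    multipliers less than 2 apart. *)
Lemma ladic_left_neighbour n (w w' : n.+1.-tuple 'I_l) (x y : R) :
  ladic_interval w x -> ladic_interval w' y -> `|x - y| <= l%:R ^- n.+1 ->
  [\/ ladic_left w' = ladic_left w - l%:R ^- n.+1 :> R,
      ladic_left w' = ladic_left w :> R |
      ladic_left w' = ladic_left w + l%:R ^- n.+1 :> R].
Proof.
have [k hk] := ladic_left_scaled n w; have [k' hk'] := ladic_left_scaled n w'.
have : 0 < l%:R ^- n.+1 :> R by rewrite invr_gt0 exprn_gt0// natr_base_gt0.
rewrite /ladic_interval /= !in_itv/= hk hk'; set d := _ ^- _ => d0.
move=> /andP[x0 x1] /andP[y0 y1]; rewrite ler_norml => /andP[xy1 xy2].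
have : k%:R * d < (k'%:R + 2) * d by lra.
have : k'%:R * d < (k%:R + 2) * d by lra.
rewrite !ltr_pM2r// -!natrD !ltr_nat => h1 h2.
have [e|[e|e]] : k = k'.+1 \/ (k' = k \/ k' = k.+1) by lia.
- by apply: Or31; rewrite e -natr1; ring.
- by apply: Or32; rewrite e.
- by apply: Or33; rewrite e -natr1; ring.
Qed.

Lemma measurable_ladic_interval n (w : n.+1.-tuple 'I_l) :
  measurable (ladic_interval w : set (measurableTypeR R)).
Proof. exact: measurable_itv. Qed.

Lemma inv_base_lt1 : `|(l%:R : R)^-1| < 1.
Proof.
rewrite ger0_norm ?invr_ge0 ?(ltW natr_base_gt0)// invf_lt1 ?natr_base_gt0//.
by rewrite ltr1n.
Qed.

Lemma exprVn_lt_eventually (e : R) :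
  0 < e -> exists N, forall n, (N <= n)%N -> l%:R ^- n < e.
Proof.
move=> e0; have /cvgr0Pnorm_lt/(_ e e0)[N _ hN] := cvg_expr inv_base_lt1.
exists N => n /hN /=; rewrite exprVn ger0_norm// invr_ge0 exprn_ge0//.
Qed.

End Cells.

(** * Lower bounds on Hausdorff measure from the mass of cells *)

Section MassDistribution.
Context {R : realType} {l : nat} (l_ge2 : (2 <= l)%N).
Context (m : probability (measurableTypeR R) R).

Lemma diameter_ub (U : set R) (x y : R) : U x -> U y -> (`|x - y|%:E <= diameter U)%E.
Proof. by move=> Ux Uy; apply: ereal_sup_ubound; exists (x, y). Qed.

Lemma diameter_le (U : set R) (d : R) :
  (forall x y, U x -> U y -> `|x - y| <= d) -> (diameter U <= d%:E)%E.
Proof.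
by move=> h; apply: ge_ereal_sup => _ [[x y] [/= Ux Uy] <-]; rewrite lee_fin h.
Qed.

Lemma gauge_ge0 (s : R) (U : set R) : (0 <= gauge s U)%E.
Proof. by rewrite /gauge; case: ifP => // _; exact: poweR_ge0. Qed.

Lemma ladic_neighbours n (s : R) (W : set (n.+1.-tuple 'I_l)) (w0 : n.+1.-tuple 'I_l) :
  (forall w, W w -> (m (ladic_interval w) <= ((l%:R ^- n.+1) `^ s)%:E)%E) ->
  exists2 B : set (measurableTypeR R), measurable B /\
    (m B <= 3%:E * ((l%:R ^- n.+1) `^ s)%:E)%E &
  forall x w y, ladic_interval w0 x -> W w -> ladic_interval w y ->
    `|x - y| <= l%:R ^- n.+1 -> B y.
Proof.
move=> Wm; set d : R := l%:R ^- n.+1.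
pose J (k : R) : set (measurableTypeR R) :=
  [set` `[ladic_left w0 + k, ladic_left w0 + k + d[].
(* A neighbouring interval is kept only if it is a cell of [W], since only then is its mass
   controlled. *)
pose B k :=
  if `[< exists2 w, W w & ladic_left w = ladic_left w0 + k >] then J k else set0.
have mB k : measurable (B k).
  by rewrite /B; case: ifP => _ //; exact: measurable_itv.
have mBd k : (m (B k) <= (d `^ s)%:E)%E.
  rewrite /B; case: asboolP => [[w Ww wk]|_]; last by rewrite measure0 lee_fin powR_ge0.
  by have := Wm w Ww; rewrite /ladic_interval wk.
exists (B (- d) `|` B 0 `|` B d).
  split; first by do !apply: measurableU.
  apply: le_trans (measureU2 _ _ _) _ => //; first exact: measurableU.
  rewrite (_ : 3%:E = 1 + 1 + 1)%E; last by rewrite -!EFinD; congr EFin; ring.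
  rewrite !ge0_muleDl ?adde_ge0// mul1e leeD//.
    by apply: le_trans (measureU2 _ _ _) _ => //; apply: leeD; exact: mBd.
  exact: mBd.
move=> x w y w0x Ww wy xy.
have Bk k : ladic_left w = ladic_left w0 + k -> B k y.
  move=> wk; rewrite /B; case: asboolP => [_|]; last by case; exists w.
  by move: wy; rewrite /ladic_interval wk.
have [h|h|h] := ladic_left_neighbour l_ge2 n w0 w x y w0x wy xy.
- by left; left; exact: Bk.
- by left; right; apply: Bk; rewrite h addr0.
- by right; exact: Bk.
Qed.

(** A set of diameter [r], with [l^-(n+2) < r <= l^-(n+1)], meets [F] inside three cells of level
    [n], each of mass at most [(l r)^s]; hence the constant. As [U] may fail to be measurable, the
    bound is put on a measurable [B]. *)
Lemma mass_bound (F : set R) (s : R) N : 0 <= s ->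
  (forall x, F x -> forall n, (N <= n)%N -> exists2 w : n.+1.-tuple 'I_l,
    ladic_interval w x & (m (ladic_interval w) <= ((l%:R ^- n.+1) `^ s)%:E)%E) ->
  forall U : set R, (diameter U <= (l%:R ^- N.+1)%:E)%E ->
  exists2 B : set (measurableTypeR R), measurable B /\
    (m B <= (3 * l%:R `^ s)%:E * gauge s U)%E & U `&` F `<=` B.
Proof.
move=> s0 hF U dU.
have l0 : 0 < l%:R :> R := natr_base_gt0 l_ge2.
have c0 : 0 <= 3 * l%:R `^ s :> R by rewrite mulr_ge0 ?powR_ge0.
have [UF0|/set0P[y [Uy Fy]]] := eqVneq (U `&` F) set0.
  exists set0; last by rewrite UF0.
  by split=> //; rewrite measure0 mule_ge0 ?lee_fin// gauge_ge0.
have gU : gauge s U = poweR (diameter U) s.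
  by rewrite /gauge ifF//; apply/negbTE/set0P; exists y.
have d0 : (0 <= diameter U)%E.
  by have := diameter_ub U y y Uy Uy; rewrite subrr normr0.
have dfin : diameter U \is a fin_num.
  by rewrite ge0_fin_numE//; apply: le_lt_trans dU _; exact: ltry.
move: gU d0 dU (diameter_ub U); rewrite -(fineK dfin); set r := fine _.
rewrite poweR_EFin !lee_fin => -> r0 rN Ur.
have {}Ur x : U x -> `|y - x| <= r by move=> Ux; have := Ur y x Uy Ux; rewrite lee_fin.
(* At diameter 0 no scale [n] fits. For [s = 0] the gauge is [0^0 = 1]; for [s > 0] the gauge
   vanishes, and the shrinking cells around [y] show that [y] is not an atom. *)
have [r00|rpos] := eqVneq r 0.
  exists [set y]; last first.
    move=> x [/Ur]; rewrite r00 normr_le0 subr_eq0 => /eqP + _.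
    by move=> ->.
  split; first exact: measurable_set1.
  have my1 : (m [set y] <= 1)%E by apply: probability_le1; exact: measurable_set1.
  have [s00|sN0] := eqVneq s 0.
    by rewrite s00 !powRr0 mulr1 mule1; apply: le_trans my1 _; rewrite lee_fin ler1n.
  rewrite r00 powR0// mule0 leNgt; apply/negP => my0.
  have spos : 0 < s by rewrite lt0r sN0.
  have mfin : m [set y] \is a fin_num by rewrite ge0_fin_numE// (le_lt_trans my1)// ltry.
  have [|n0 hn0] := exprVn_lt_eventually l_ge2 ((fine (m [set y])) `^ s^-1).
    by rewrite powR_gt0// fine_gt0// my0 -ge0_fin_numE.
  pose n := maxn N n0.
  have [w wy mw] := hF y Fy n (leq_maxl _ _).
  have := hn0 n.+1 (leqW (leq_maxr _ _)).
  have powK (x : R) : 0 <= x -> (x `^ s) `^ s^-1 = x.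
    by move=> x0; rewrite -powRrM mulfV// powRr1.
  apply/negP; rewrite -leNgt -[leRHS]powK ?invr_ge0 ?exprn_ge0 ?(ltW l0)//.
  rewrite ge0_ler_powR ?nnegrE ?powR_ge0 ?fine_ge0 ?invr_ge0//.
  rewrite -lee_fin fineK//; apply: le_trans mw; apply: le_measure; rewrite ?inE.
  - exact: measurable_set1.
  - exact: measurable_ladic_interval.
  - by move=> _ ->.
have {r0}rpos : 0 < r by rewrite lt0r rpos.
have [k0 hk0] := exprVn_lt_eventually l_ge2 r rpos.
have exk : exists k, l%:R ^- (N + k).+2 < r.
  by exists k0; apply: hk0; rewrite -addn2 -addnA addnCA leq_addr.
(* Minimality of [k] gives the upper bound on [r]; for [k = 0] it is the assumed bound on the
   diameter. *)
case: (ex_minnP exk) => k rk kmin.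
pose n := (N + k)%N.
have rn : r <= l%:R ^- n.+1.
  case: k rk kmin @n => [|k] rk kmin n; first by rewrite /n addn0.
  rewrite leNgt; apply/negP; rewrite /n addnS => rk'.
  by have := kmin k rk'; rewrite ltnn.
have [w0 w0y _] := hF y Fy n (leq_addr _ _).
pose W := [set w : n.+1.-tuple 'I_l |
  (m (ladic_interval w) <= ((l%:R ^- n.+1) `^ s)%:E)%E].
have [B [mB Bd] BW] := ladic_neighbours n s W w0 (fun w h => h).
exists B; last first.
  move=> x [Ux Fx]; have [w wx mw] := hF x Fx n (leq_addr _ _).
  by apply: (BW y w x) => //; apply: le_trans rn; exact: Ur.
split=> //; apply: le_trans Bd _.
rewrite -!EFinM lee_fin -mulrA ler_pM2l// -powRM ?(ltW l0) ?(ltW rpos)//.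
rewrite ge0_ler_powR ?nnegrE ?invr_ge0 ?exprn_ge0 ?mulr_ge0 ?(ltW l0) ?(ltW rpos)//.
rewrite -ler_pdivrMl//; apply: le_trans (ltW rk).
by rewrite -invfM -exprS.
Qed.

(** Mass distribution principle: every cover of [E] at scale [l^-(N+1)] has gauge sum at least
    [m F / c], so that premeasure is already positive. *)
Lemma hausdorff_measure_neq0 (E F : set R) (s : R) N :
  0 <= s -> measurable (F : set (measurableTypeR R)) -> F `<=` E -> (0 < m F)%E ->
  (forall x, F x -> forall n, (N <= n)%N -> exists2 w : n.+1.-tuple 'I_l,
    ladic_interval w x & (m (ladic_interval w) <= ((l%:R ^- n.+1) `^ s)%:E)%E) ->
  hausdorff_measure s E <> 0%E.
Proof.
move=> s0 mF FE F0 hF Hs.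
have l0 : 0 < l%:R :> R := natr_base_gt0 l_ge2.
pose c : R := 3 * l%:R `^ s.
have c0 : 0 < c by rewrite mulr_gt0 ?powR_gt0.
have : (hausdorff_premeasure s (l%:R ^- N.+1) E <= 0)%E.
  rewrite -Hs; apply: ereal_sup_ubound; exists (l%:R ^- N.+1) => //=.
  by rewrite invr_gt0 exprn_gt0.
apply/negP; rewrite -ltNge; apply: (@lt_le_trans _ _ (c^-1%:E * m F)%E).
  by rewrite mule_gt0// lte_fin invr_gt0.
apply: le_ereal_inf_tmp => _ [U [EU dU] <-].
rewrite lee_pdivrMl// -nneseriesZl; last by move=> i _; exact: gauge_ge0.
have /choice[B hB] : forall i, exists B : set (measurableTypeR R),
    [/\ measurable B, (m B <= c%:E * gauge s (U i))%E & U i `&` F `<=` B].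
  move=> i; have [B [mB Bd] UB] := mass_bound F s N s0 hF (U i) (dU i).
  by exists B.
apply: (@le_trans _ _ (\sum_(0 <= i <oo) m (B i))%E).
  apply: measure_sigma_subadditive => // [i|]; first by have [] := hB i.
  move=> x Fx; have [i _ Ux] := EU x (FE x Fx).
  by exists i => //; have [_ _] := hB i; apply.
by apply: lee_nneseries => // i _; have [] := hB i.
Qed.

End MassDistribution.

(** * Coverings *)

Section Covers.
Context {R : realType}.
Local Open Scope ereal_scope.

(** A bijection of [nat] with [nat * nat] flattens the lists into one sequence. Positions past the
    end of a list yield [set0], of diameter [-oo] and gauge 0. *)
Lemma hausdorff_premeasure_le_cover (s d : R) (E : set R) (V : nat -> seq (set R)) :
  (forall n U, U \in V n -> diameter U <= d%:E) ->
  (forall x, E x -> exists n, exists2 U, U \in V n & U x) ->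
  hausdorff_premeasure s d E <= \sum_(0 <= n <oo) \sum_(U <- V n) gauge s U.
Proof.
move=> Vd EV.
have [e ebij] : exists e : nat -> nat * nat, set_bij [set: nat] [set: nat * nat] e.
  by apply/card_set_bijP; rewrite card_eq_sym; exact: card_nat2.
have g0 U : 0 <= gauge s U by exact: gauge_ge0.
pose a (x : nat * nat) := nth set0 (V x.1) x.2.
apply: (@le_trans _ _ (\sum_(0 <= k <oo) gauge s (a (e k)))).
  apply: ereal_inf_lbound; exists (a \o e) => //; split.
    move=> x /EV[n [U UV Ux]].
    have [_ _ esurj] := ebij; have [k _ ek] := esurj (n, index U (V n)) I.
    by exists k => //; rewrite /= /a ek /= nth_index.
  move=> n /=; rewrite /a; set j := (e n).2; set W := V _.
  have [jW|Wj] := ltnP j (size W); first by apply: Vd; exact: mem_nth.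
  rewrite nth_default//; apply: ge_ereal_sup => _ [z [[]]].
rewrite nneseries_esumT// -(@reindex_esum _ _ _ _ _ e (fun x => gauge s (a x)) ebij).
have -> : [set: nat * nat] = [set: nat] `*`` (fun=> [set: nat]).
  by apply/seteqP; split.
rewrite -(esum_esum (a := fun i j => gauge s (nth set0 (V i) j)))//.
rewrite nneseries_esumT; last by move=> n; exact: sume_ge0.
apply: le_esum => n _; rewrite -nneseries_esumT//.
apply: lime_le; first by apply: is_cvg_nneseries => i _ _.
apply: nearW => N; rewrite [leRHS](big_nth set0).
have [NV|VN] := leqP N (size (V n)).
  by apply: lee_sum_nneg_natr => // i _ _.
rewrite (@big_cat_nat _ _ _ (size (V n)))//= ?(ltnW VN)//.
rewrite [X in _ + X]big_nat_cond [X in _ + X]big1 ?adde0// => i /andP[/andP[Vi _] _].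
by rewrite nth_default// /gauge eqxx.
Qed.

Lemma hausdorff_measure_eq0 (s : R) (E : set R) :
  (forall d e : R, (0 < d)%R -> (0 < e)%R -> exists V : nat -> seq (set R),
    [/\ forall n U, U \in V n -> diameter U <= d%:E,
        forall x, E x -> exists n, exists2 U, U \in V n & U x &
        forall n, \sum_(U <- V n) gauge s U <= (e / (2 ^ n.+1)%:R)%:E]) ->
  hausdorff_measure s E = 0.
Proof.
move=> h; apply/eqP; rewrite eq_le; apply/andP; split.
  apply: ge_ereal_sup => _ [d /= d0 <-]; apply/lee_addgt0Pr => e e0.
  have [V [Vd EV Ve]] := h d e d0 e0.
  apply: le_trans (hausdorff_premeasure_le_cover s d E V Vd EV) _.
  rewrite add0e; apply: le_trans (epsilon_trick0 xpredT (ltW e0)).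
  apply: lee_nneseries => // n _ _; apply: sume_ge0 => U _; exact: gauge_ge0.
apply: (@le_trans _ _ (hausdorff_premeasure s 1 E)).
  apply: le_ereal_inf_tmp => _ [U _ <-]; apply: nneseries_ge0 => n _ _.
  exact: gauge_ge0.
by apply: ereal_sup_ubound; exists 1%R => //=.
Qed.

End Covers.

(** * Almost sure behaviour of the cells and the two dimension bounds *)

Section Typical.
Context {R : realType} {l : nat} (l_ge2 : (2 <= l)%N).
Context (p pi : 'rV[R]_l) (P : 'M[R]_l) (m : probability (measurableTypeR R) R).
Context (p_prob : probability_vector p) (P_stoch : stochastic P).
Context (P_irr : irreducible P) (pi_stat : stationary P pi).
Context (m_driven : driven_by p P m).
Let D := dot pi (row_entropies P).

Lemma words_union n (A : pred (n.+1.-tuple 'I_l)) :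
  exists B : set (measurableTypeR R), [/\ measurable B,
    (m B <= (\sum_(w | A w) word_prob p P w)%:E)%E &
    forall w x, A w -> ladic_interval w x -> B x].
Proof.
have [_ mI] := m_driven.
exists (\big[setU/set0]_(w | A w) (ladic_interval w : set (measurableTypeR R))).
have [mB ?] : measurable (\big[setU/set0]_(w | A w) (ladic_interval w : set (measurableTypeR R)))
  /\ (m (\big[setU/set0]_(w | A w) (ladic_interval w : set (measurableTypeR R)))
     <= (\sum_(w | A w) word_prob p P w)%:E)%E.
  apply: (big_rec2 (fun (B : set (measurableTypeR R)) x => measurable B /\ (m B <= x%:E)%E)).
    by rewrite measure0.
  move=> w B x _ [mB Bx]; have mw := measurable_ladic_interval n w.
  split; first exact: measurableU.
  apply: le_trans (measureU2 _ _ _) _ => //.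
  have Iw : (m (ladic_interval w) <= (word_prob p P w)%:E)%E by rewrite mI.
  by rewrite EFinD; apply: leeD.
split=> // w x Aw wx.
by rewrite (bigD1 w)//=; left.
Qed.

(** Borel-Cantelli: the masses of the atypical cells are bounded by a geometric series. *)
Lemma atypical_negligible (d : R) : 0 < d ->
  exists B : nat -> set (measurableTypeR R), [/\ forall n, measurable (B n),
    m (lim_sup_set B) = 0%E &
    forall n (w : n.+1.-tuple 'I_l) x, atypical p P D d n w -> ladic_interval w x -> B n x].
Proof.
move=> d0.
have [C [q [/andP[q0 q1] Cq]]] :=
  atypical_sum p P pi d l_ge2 p_prob P_stoch P_irr pi_stat d0.
have /choice[B hB] := fun n => words_union n (atypical p P D d n).
exists B; split=> [n| |n w x]; [by have [] := hB n| |by have [_ _] := hB n; exact].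
apply: lim_sup_set_cvg0 => [n|]; first by have [] := hB n.
apply: (@le_lt_trans _ _ ((`|C| * (1 - q)^-1)%:E)); last exact: ltry.
apply: lime_le; first by apply: is_cvg_nneseries => n _ _.
apply: nearW => n.
apply: (@le_trans _ _ (\sum_(0 <= i < n) (`|C| * q ^+ i)%:E)%E).
  apply: lee_sum => i _; have [_ + _] := hB i => /le_trans; apply.
  rewrite lee_fin; apply: le_trans (Cq i) _.
  by rewrite ler_wpM2r ?exprn_ge0 ?ler_norm// ltW.
rewrite sumEFin lee_fin; apply: (geometric_le_lim n (normr_ge0 C) q0).
by rewrite ger0_norm// ltW.
Qed.

Lemma ln_powR_exprVn (s : R) n :
  ln ((l%:R ^- n.+1) `^ s) = - (n.+1%:R * s * ln l%:R) :> R.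
Proof.
have l0 : 0 < l%:R :> R := natr_base_gt0 l_ge2.
rewrite ln_powR lnV ?posrE ?exprn_gt0// lnXn// -mulr_natl; ring.
Qed.

Lemma typical_le (s : R) : 0 <= s -> s < D -> exists2 d, 0 < d &
  exists N, forall n, (N <= n)%N -> forall w : n.+1.-tuple 'I_l,
  ~~ atypical p P D d n w -> word_prob p P w <= (l%:R ^- n.+1) `^ s.
Proof.
move=> s0 sD; have L0 := ln_natr_gt0 (R := R) l_ge2.
have l0 : 0 < l%:R :> R := natr_base_gt0 l_ge2.
(* Half of the gap pays for the deviation; the other half, times [n], eventually absorbs the extra
   [s * ln l%:R] due to length [n.+1]. *)
pose d := (D - s) * ln l%:R / 2.
have d0 : 0 < d by rewrite divr_gt0// mulr_gt0// subr_gt0.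
have [N hN] := natr_mul_ge_eventually d (s * ln l%:R) d0.
exists d => //; exists N => n /hN sn w.
rewrite /atypical negb_or -ltNge ltr_norml => /andP[w0 /andP[_ w1]].
rewrite -ler_ln ?posrE ?powR_gt0 ?invr_gt0 ?exprn_gt0//; last first.
  by rewrite lt0r w0 word_prob_ge0//; [case: p_prob|move=> i j; exact: stochastic_ge0].
rewrite ln_powR_exprVn -natr1.
have e1 : n%:R * (D * ln l%:R) = n%:R * s * ln l%:R + n%:R * d + n%:R * d.
  by rewrite /d; field.
lra.
Qed.

Lemma typical_ge (s : R) : 0 <= s -> D < s -> exists2 d, 0 < d &
  forall n (w : n.+1.-tuple 'I_l),
  ~~ atypical p P D d n w -> (l%:R ^- n.+1) `^ s <= word_prob p P w.
Proof.
move=> s0 sD; have L0 := ln_natr_gt0 (R := R) l_ge2.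
have l0 : 0 < l%:R :> R := natr_base_gt0 l_ge2.
(* Here the extra letter helps, so the whole gap goes to the deviation and every [n] is allowed. *)
pose d := (s - D) * ln l%:R.
have d0 : 0 < d by rewrite mulr_gt0// subr_gt0.
exists d => // n w.
rewrite /atypical negb_or -ltNge ltr_norml => /andP[w0 /andP[w1 _]].
rewrite -ler_ln ?posrE ?powR_gt0 ?invr_gt0 ?exprn_gt0//; last first.
  by rewrite lt0r w0 word_prob_ge0//; [case: p_prob|move=> i j; exact: stochastic_ge0].
rewrite ln_powR_exprVn -natr1.
have e1 : n%:R * (D * ln l%:R) = n%:R * s * ln l%:R - n%:R * d by rewrite /d; ring.
have : 0 <= s * ln l%:R by rewrite mulr_ge0// ltW.
lra.
Qed.

Lemma measure_setC01 : m (~` `[0, 1[%classic) = 0%E.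
Proof.
have [m01 _] := m_driven; rewrite probability_setC; last exact: measurable_itv.
by rewrite m01 subee.
Qed.

Lemma lower_dim_ge : (D%:E <= lower_dim m)%E.
Proof.
apply: le_ereal_inf_tmp => _ [E [mE E0] <-].
apply: le_ereal_inf_tmp => _ [s [s0 Hs] <-].
rewrite lee_fin leNgt; apply/negP => sD.
have [d d0 [N hN]] := typical_le s s0 sD.
have [B [mB B0 hB]] := atypical_negligible d d0.
(* On [F k] all cells from level [k] on are typical. These sets exhaust [E] up to a null set, so one
   of them has positive mass. *)
pose F k : set (measurableTypeR R) :=
  (E `&` `[0, 1[%classic) `\` \bigcup_(j >= k) B j.
have mF k : measurable (F k).
  apply: measurableD; last exact: bigcup_measurable.
  by apply: measurableI => //; exact: measurable_itv.
have [k Fk] : exists k, (0 < m (F k))%E.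
  apply: contrapT => /forallNP Fk0.
  have Fneg k : m.-negligible (F k).
    apply/negligibleP => //; apply/eqP; rewrite -measure_le0 leNgt; apply/negP.
    exact: Fk0.
  have : m E = 0%E.
    apply: measure_negligible => //.
    apply: (@negligibleS _ _ _ _ ((\bigcup_k F k `|` lim_sup_set B) `|` ~` `[0, 1[%classic)).
      move=> x Ex; have [x01|x01] := pselect (`[0, 1[%classic x); last by right.
      left; have [xB|/existsNP[k /not_implyP[_ xBk]]] := pselect (lim_sup_set B x).
        by right.
      by left; exists k.
    apply: negligibleU.
      apply: negligibleU; first exact: negligible_bigcup.
      apply/negligibleP => //; apply: bigcap_measurable => // k _.
      exact: bigcup_measurable.
    apply/negligibleP; last exact: measure_setC01.
    by apply: measurableC; exact: measurable_itv.
  by move/eqP; rewrite gt_eqF.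
apply: (hausdorff_measure_neq0 l_ge2 m E (F k) s (maxn k N) s0 (mF k) _ Fk _ Hs).
  by move=> x [[]].
move=> x [[Ex x01] xB] n; rewrite geq_max => /andP[kn Nn].
have [|w wx] := ladic_interval_exists l_ge2 n x; first by move: x01; rewrite /= in_itv.
exists w => //; have [_ ->] := m_driven; rewrite lee_fin hN//.
by apply/negP => wat; apply: xB; exists n => //; exact: hB wx.
Qed.

(** For [t] strictly between [D] and [s], cells of mass at least [diam^t] satisfy
    [diam^s <= diam^(s-t) * mass]. Their gauge sum at one level is thus at most [diam^(s-t)], which
    tends to 0. *)
Lemma upper_dim_le_gt (s : R) : D < s -> (upper_dim m <= s%:E)%E.
Proof.
move=> Ds; have D0 : 0 <= D by case: pi_stat => ? _; exact: dot_entropies_ge0.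
have l0 : 0 < l%:R :> R := natr_base_gt0 l_ge2.
pose t := (D + s) / 2; have Dt : D < t by rewrite /t; lra.
have ts : 0 < s - t by rewrite /t; lra.
have t0 : 0 <= t by lra.
have [d d0 hd] := typical_ge t t0 Dt.
have [B [mB B0 hB]] := atypical_negligible d d0.
have mZ : measurable (lim_sup_set B).
  by apply: bigcap_measurable => // k _; exact: bigcup_measurable.
pose E : set (measurableTypeR R) := `[0, 1[%classic `\` lim_sup_set B.
have mE : measurable E by apply: measurableD => //; exact: measurable_itv.
have mE1 : m E = 1%E.
  have : m (~` E) = 0%E.
    apply: measure_negligible; first exact: measurableC.
    apply: (@negligibleS _ _ _ _ (lim_sup_set B `|` ~` `[0, 1[%classic)).
      move=> x Ex; have [x01|x01] := pselect (`[0, 1[%classic x); last by right.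
      by left; apply: contrapT => xZ; exact: Ex.
    apply: negligibleU; first exact/negligibleP.
    apply/negligibleP; last exact: measure_setC01.
    by apply: measurableC; exact: measurable_itv.
  by move=> h; rewrite -[E]setCK probability_setC ?h ?sube0//; exact: measurableC.
apply: (@le_trans _ _ (hausdorff_dim E)); first by apply: ereal_inf_lbound; exists E.
apply: ereal_inf_lbound; exists s => //; split; first lra.
apply: hausdorff_measure_eq0 => d' e d'0 e0.
have [N hN] := exprVn_lt_eventually l_ge2 d' d'0.
(* Level [f k] has small cells, lies beyond [k] so that points outside every [B j] with [j >= k] are
   covered, and meets the budget [e / 2^(k+1)]. *)
have /choice[f hf] : forall k, exists n, [/\ (N <= n)%N, (k <= n)%N &
    (l%:R ^- n.+1) `^ (s - t) <= e / (2 ^ k.+1)%:R].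
  move=> k; pose c := e / (2 ^ k.+1)%:R.
  have c0 : 0 < c by rewrite divr_gt0// ltr0n expn_gt0.
  have [M hM] := exprVn_lt_eventually l_ge2 (c `^ (s - t)^-1) (powR_gt0 _ c0).
  exists (maxn N (maxn k M)); rewrite !leq_max !leqnn !orbT; split=> //.
  have powK : (c `^ (s - t)^-1) `^ (s - t) = c.
    by rewrite -powRrM mulVf ?lt0r_neq0// powRr1// ltW.
  rewrite -/c -[leRHS]powK.
  rewrite ge0_ler_powR ?nnegrE ?(ltW ts) ?powR_ge0 ?invr_ge0 ?exprn_ge0 ?(ltW l0)//.
  by apply/ltW/hM; rewrite leqW// !leq_max leqnn !orbT.
pose good n (w : n.+1.-tuple 'I_l) := (l%:R ^- n.+1) `^ t <= word_prob p P w.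
exists (fun k => [seq (ladic_interval w : set R) | w <- enum (good (f k))]).
have Idiam n (w : n.+1.-tuple 'I_l) :
    (diameter (ladic_interval w) <= (l%:R ^- n.+1 : R)%:E)%E.
  apply: diameter_le => x y; rewrite /ladic_interval/= !in_itv/=.
  by move=> /andP[? ?] /andP[? ?]; rewrite ler_norml; apply/andP; split; lra.
split.
- move=> k U /mapP[w _ ->]; apply: le_trans (Idiam _ w) _.
  by have [Nf _ _] := hf k; rewrite lee_fin ltW// hN// ltnW.
- move=> x [x01 /existsNP[k /not_implyP[_ xB]]]; exists k.
  have [|w wx] := ladic_interval_exists l_ge2 (f k) x.
    by move: x01; rewrite /= in_itv.
  exists (ladic_interval w) => //; apply/map_f; rewrite mem_enum; apply: hd.
  apply/negP => wat; apply: xB; exists (f k); first by have [] := hf k.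
  exact: hB wx.
move=> k; have [_ _ fk] := hf k; set n := f k in fk *.
rewrite big_map big_enum/=.
apply: (@le_trans _ _ (\sum_(w | good n w)
    ((l%:R ^- n.+1) `^ (s - t) * word_prob p P w)%:E)%E).
  apply: lee_sum => w gw.
  apply: (@le_trans _ _ (((l%:R ^- n.+1) `^ s)%:E)).
    rewrite /gauge; case: eqP => [_|/eqP/set0P[x wx]]; first by rewrite lee_fin powR_ge0.
    rewrite -poweR_EFin; apply: gt0_ler_poweR; rewrite ?in_itv/= ?leey ?andbT//.
      lra.
    by have := diameter_ub _ x x wx wx; rewrite subrr normr0.
  (* Splitting [s] as [(s - t) + t] lets the factor of exponent [t] be replaced by the mass of a
     good cell. *)
  rewrite lee_fin -{1}(subrK t s) (powRD (r := s - t)); last first.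
    by apply/implyP => _; rewrite invr_neq0// expf_neq0// gt_eqF.
  by rewrite ler_wpM2l ?powR_ge0.
rewrite sumEFin lee_fin -mulr_sumr; apply: le_trans fk.
apply: ler_piMr; first exact: powR_ge0.
have [p0 <-] := p_prob; apply: le_trans (sum_word_prob_le p P n p0 _ _).
- rewrite big_mkcond ler_sum// => w _; case: ifP => // _.
  by rewrite word_prob_ge0// => i j; exact: stochastic_ge0.
- by move=> i j; exact: stochastic_ge0.
- by move=> i; rewrite stochastic_sum.
Qed.

Lemma upper_dim_le : (upper_dim m <= D%:E)%E.
Proof.
apply/lee_addgt0Pr => e e0; rewrite -EFinD; apply: upper_dim_le_gt.
by rewrite ltrDl.
Qed.

Lemma lower_dim_le_upper_dim : (lower_dim m <= upper_dim m)%E.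
Proof.
apply: ereal_inf_le_tmp => _ [E [mE E1] <-]; exists E => //; split=> //.
by rewrite E1.
Qed.

End Typical.

Theorem theorem3p8 (R : realType) (l : nat) (l_ge2 : (2 <= l)%N)
    (p : 'rV[R]_l) (P : 'M[R]_l)
    (p_prob : probability_vector p)
    (P_stoch : stochastic P)
    (P_neq1 : forall i j, P i j <> 1)
    (P_irr : irreducible P)
    (m : probability (measurableTypeR R) R)
    (m_driven : driven_by p P m)
    (pi : 'rV[R]_l)
    (pi_stat : stationary P pi) :
  unidimensional m /\
  measure_dim m = (dot pi (row_entropies P))%:E /\
  dot pi (row_entropies P) = \sum_(k < l) pi 0 k * entropy (row k P).
Proof.
have lower_ge := lower_dim_ge l_ge2 p pi P m p_prob P_stoch P_irr pi_stat m_driven.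
have upper_le := upper_dim_le l_ge2 p pi P m p_prob P_stoch P_irr pi_stat m_driven.
have lower_upper := lower_dim_le_upper_dim m.
have lowerE : lower_dim m = (dot pi (row_entropies P))%:E.
  by apply/eqP; rewrite eq_le lower_ge (le_trans lower_upper).
split; [|split].
- by apply/eqP; rewrite eq_le lower_upper lowerE.
- exact: lowerE.
- by rewrite /dot; apply: eq_bigr => k _; rewrite mxE.
Qed.
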